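(* Let $R$ be a right (resp., left) perfect periodic ring and let $G$ be a locally finite group. Then the group ring $RG$ is a periodic ring.
   Context: All rings are associative with identity (not necessarily commutative). A ring $R$ is periodic if for every $x\in R$ there exist distinct positive integers $m\neq n$ with $x^m=x^n$. $J(R)$ is the Jacobson radical. A ring $R$ is right perfect if $R/J(R)$ is semisimple (Artinian) and for every sequence $a_1,a_2,\ldots$ of elements of $J(R)$ there is an integer $k\ge 1$ with $a_1a_2\cdots a_k=0$; left perfect is the left-right symmetric notion (with $a_k\cdots a_2a_1=0$). A group is locally finite if each of its finitely generated subgroups is finite. *)

(* Defs.v *)
From HB Require Import structures.
From mathcomp Require Import all_boot all_algebra.
From mathcomp Require Import finmap.
From mathcomp Require Import monalg.
From mathcomp Require Import boolp classical_sets cardinality.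

Set Implicit Arguments.
Unset Strict Implicit.
Unset Printing Implicit Defensive.

Import GRing.Theory.

Local Open Scope classical_set_scope.
Local Open Scope ring_scope.

(* [pzRingType]: associative unital rings, not necessarily commutative; the
   zero ring is allowed. *)
Definition periodic_ring (R : pzRingType) : Prop :=
  forall x : R, exists m n : nat,
    [/\ (0 < m)%N, (0 < n)%N, m <> n & x ^+ m = x ^+ n].

Section Ideals.
Variable R : pzRingType.

Definition left_ideal (I : set R) : Prop :=
  [/\ I 0, (forall x y, I x -> I y -> I (x - y))
    & (forall a x, I x -> I (a * x))].

Definition maximal_left_ideal (M : set R) : Prop :=
  [/\ left_ideal M, M <> setT
    & forall N, left_ideal N -> M `<=` N -> N = M \/ N = setT].

(* The intersection of an empty family is [setT], as it must be for the zero
   ring. *)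
Definition jacobson_radical : set R := \bigcap_(M in maximal_left_ideal) M.

(* The left regular module is semisimple: every submodule is a direct summand.
   Such a ring is automatically left and right Artinian. *)
Definition semisimple_ring : Prop :=
  forall I, left_ideal I ->
    exists K, [/\ left_ideal K, I `&` K = [set 0]
                & forall x, exists y z, [/\ I y, K z & x = y + z]].

Lemma left_idealD (I : set R) x y : left_ideal I -> I x -> I y -> I (x + y).
Proof.
move=> [I0 IB _] Ix Iy; rewrite -[y]opprK -[- y]add0r.
by apply: (IB) => //; apply: IB.
Qed.

Lemma jacobson_left_ideal : left_ideal jacobson_radical.
Proof.
split=> [M [[]]//|x y Jx Jy M maxM|a x Jx M maxM].
- by have [[_ MB _] _ _] := maxM; apply: MB; [apply: Jx|apply: Jy].
- by have [[_ _ MM] _ _] := maxM; apply: MM; apply: Jx.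
Qed.

Lemma jacobsonMr x r : jacobson_radical x -> jacobson_radical (x * r).
Proof.
move=> Jx M maxM; have [idM _ topM] := maxM; have [M0 MB MM] := idM.
have [Mr|nMr] := pselect (M r); first exact: MM.
suff: maximal_left_ideal [set y | M (y * r)] by move/Jx.
split=> [|eqT|N idN sMN].
- split=> [|y z|a y] /=; rewrite ?mul0r ?mulrBl -?mulrA //; first exact: MB.
  exact: MM.
- by apply: nMr; rewrite -[r]mul1r; have : setT (1 : R) by []; rewrite -eqT.
have [sNM|/existsNP[n /not_implyP[Nn nMn]]] :=
    pselect (forall n, N n -> M (n * r)).
  by left; apply/seteqP; split.
right; apply/seteqP; split=> // y _; have [_ NB NM] := idN.
pose P := [set z | exists m s, M m /\ z = m + s * (n * r)].
have idP : left_ideal P.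
  split=> [|z z' [m [s [Mm ->]]] [m' [s' [Mm' ->]]]|a z [m [s [Mm ->]]]].
  - by exists 0, 0; rewrite mul0r addr0.
  - exists (m - m'), (s - s'); split; first exact: MB.
    by rewrite mulrBl opprD addrACA.
  - by exists (a * m), (a * s); split; [exact: MM|rewrite mulrDr mulrA].
have sMP : M `<=` P by move=> m Mm; exists m, 0; rewrite mul0r addr0.
have [eqPM|eqPT] := topM P idP sMP.
  case: nMn; rewrite -eqPM; exists 0, 1; by rewrite mul1r add0r.
have [m [s [Mm yrE]]] : P (y * r) by rewrite eqPT.
rewrite -[y](subrK (s * n)); apply: left_idealD => //; last exact: NM.
by apply: sMN; rewrite /= mulrBl yrE -mulrA addrK.
Qed.

Definition jacobson_pred : {pred R} := fun x => x \in jacobson_radical.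

Lemma jacobson_zmod_closed : zmod_closed jacobson_pred.
Proof.
have [J0 JB _] := jacobson_left_ideal.
split=> [|x y /set_mem Jx /set_mem Jy]; first exact: mem_set J0.
exact: mem_set (JB _ _ Jx Jy).
Qed.

HB.instance Definition _ :=
  GRing.isZmodClosed.Build R jacobson_pred jacobson_zmod_closed.

Definition jacobson_quotient : Type := Quotient.quot jacobson_pred.

HB.instance Definition _ := GRing.Zmodule.on jacobson_quotient.

Local Open Scope quotient_scope.

Definition jacobson_proj (x : R) : jacobson_quotient :=
  \pi_(Quotient.quot jacobson_pred) x.

Definition jacobson_repr (u : jacobson_quotient) : R :=
  repr (u : Quotient.quot jacobson_pred).

Lemma jacobson_reprK : cancel jacobson_repr jacobson_proj.
Proof. by move=> u; apply: reprK. Qed.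

Lemma jacobson_proj_eq x y :
  jacobson_proj x = jacobson_proj y <-> jacobson_radical (x - y).
Proof.
rewrite /jacobson_proj; split=> [/eqP|Jxy].
  by rewrite -Quotient.idealrBE => /set_mem.
by apply/eqP; rewrite -Quotient.idealrBE; apply/mem_set.
Qed.

Lemma jacobson_proj_is_zmod_morphism : zmod_morphism jacobson_proj.
Proof.
move=> x y.
exact: (raddfB \pi_(Quotient.quot jacobson_pred) x y).
Qed.

HB.instance Definition _ :=
  GRing.isZmodMorphism.Build R jacobson_quotient jacobson_proj
    jacobson_proj_is_zmod_morphism.

Definition jacobson_quotient_one : jacobson_quotient := jacobson_proj 1.

Definition jacobson_quotient_mul (u v : jacobson_quotient) :=
  jacobson_proj (jacobson_repr u * jacobson_repr v).

Lemma jacobson_projM x y : jacobson_proj (x * y) =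
  jacobson_quotient_mul (jacobson_proj x) (jacobson_proj y).
Proof.
have [_ _ JM] := jacobson_left_ideal.
rewrite /jacobson_quotient_mul; set x' := jacobson_repr _.
set y' := jacobson_repr _; apply/jacobson_proj_eq.
rewrite -[x * y](subrK (x * y')) -mulrBr -addrA -mulrBl.
apply: (left_idealD jacobson_left_ideal).
  by apply: JM; apply/jacobson_proj_eq; rewrite jacobson_reprK.
by apply: jacobsonMr; apply/jacobson_proj_eq; rewrite jacobson_reprK.
Qed.

Let mul := jacobson_quotient_mul.
Let one := jacobson_quotient_one.

Lemma jacobson_quotient_mulA : associative mul.
Proof.
move=> u v w; rewrite -[u]jacobson_reprK -[v]jacobson_reprK -[w]jacobson_reprK.
by rewrite /mul -!jacobson_projM mulrA.
Qed.

Lemma jacobson_quotient_mul1q : left_id one mul.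
Proof.
by move=> u; rewrite -[u]jacobson_reprK /mul -jacobson_projM mul1r.
Qed.

Lemma jacobson_quotient_mulq1 : right_id one mul.
Proof.
by move=> u; rewrite -[u]jacobson_reprK /mul -jacobson_projM mulr1.
Qed.

Lemma jacobson_quotient_mulDl : left_distributive mul +%R.
Proof.
move=> u v w; rewrite -[u]jacobson_reprK -[v]jacobson_reprK -[w]jacobson_reprK.
by rewrite -raddfD /mul -!jacobson_projM mulrDl raddfD.
Qed.

Lemma jacobson_quotient_mulDr : right_distributive mul +%R.
Proof.
move=> u v w; rewrite -[u]jacobson_reprK -[v]jacobson_reprK -[w]jacobson_reprK.
by rewrite -raddfD /mul -!jacobson_projM mulrDr raddfD.
Qed.

HB.instance Definition _ := GRing.Zmodule_isPzRing.Build jacobson_quotient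
  jacobson_quotient_mulA jacobson_quotient_mul1q jacobson_quotient_mulq1
  jacobson_quotient_mulDl jacobson_quotient_mulDr.

Lemma jacobson_proj_is_monoid_morphism : monoid_morphism jacobson_proj.
Proof. by split=> // x y; rewrite jacobson_projM. Qed.

HB.instance Definition _ :=
  GRing.isMonoidMorphism.Build R jacobson_quotient jacobson_proj
    jacobson_proj_is_monoid_morphism.

(* Sequences are indexed from 0 and [\prod] multiplies from left to right, so
   the first product is [a 0 * a 1 * ... * a k.-1] and the second one is
   [a k.-1 * ... * a 1 * a 0]. *)
Definition right_T_nilpotent (J : set R) : Prop :=
  forall a : nat -> R, (forall i, J (a i)) ->
    exists k : nat, (0 < k)%N /\ \prod_(i < k) a i = 0.

Definition left_T_nilpotent (J : set R) : Prop :=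
  forall a : nat -> R, (forall i, J (a i)) ->
    exists k : nat, (0 < k)%N /\ \prod_(i < k) a (rev_ord i) = 0.

End Ideals.

Arguments jacobson_radical : clear implicits.
Arguments jacobson_quotient : clear implicits.
Arguments semisimple_ring : clear implicits.

Definition right_perfect (R : pzRingType) : Prop :=
  semisimple_ring (jacobson_quotient R) /\
  right_T_nilpotent (jacobson_radical R).

Definition left_perfect (R : pzRingType) : Prop :=
  semisimple_ring (jacobson_quotient R) /\
  left_T_nilpotent (jacobson_radical R).

Definition subgroup_set (G : groupType) (H : set G) : Prop :=
  [/\ H 1%g, (forall x y, H x -> H y -> H (x * y)%g)
    & (forall x, H x -> H (x^-1)%g)].

Definition subgroup_generated (G : groupType) (A : set G) : set G :=
  smallest (@subgroup_set G) A.

Definition locally_finite_group (G : groupType) : Prop :=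
  forall A : set G, finite_set A -> finite_set (subgroup_generated A).

(* [{malg R[G]}] is the additive group of finitely supported functions
   [G -> R]; [mcoeff g x] is the coefficient of [g] in [x] and [mkmalgU g c]
   is the monomial [c g]. The product of monalg is not available here: it
   requires a monoid in which [x * y = 1] forces [x = y = 1]. *)
Definition group_ring (R : pzRingType) (G : groupType) : Type := {malg R[G]}.

Section GroupRing.
Variables (R : pzRingType) (G : groupType).
Local Notation RG := (group_ring R G).
Implicit Types (x y z : RG) (g h : G) (c d : R).

HB.instance Definition _ := GRing.Zmodule.on RG.

Definition group_ring_monomial g c : RG := mkmalgU g c.
Definition group_ring_coeff g x : R := mcoeff g x.

Local Notation mon := group_ring_monomial.
Local Notation coeff := group_ring_coeff.

Definition group_ring_one : RG := mon 1%g 1.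

Definition group_ring_mul x y : RG :=
  \sum_(g <- msupp x) \sum_(h <- msupp y) mon (g * h)%g (coeff g x * coeff h y).

Local Notation mul := group_ring_mul.

Lemma group_ring_monomial_is_zmod_morphism g : zmod_morphism (mon g).
Proof. by move=> c d; apply: (raddfB (mkmalgU g)). Qed.

HB.instance Definition _ g :=
  GRing.isZmodMorphism.Build R RG (mon g)
    (group_ring_monomial_is_zmod_morphism g).

Lemma group_ring_coeff_is_zmod_morphism g : zmod_morphism (coeff g).
Proof. by move=> x y; apply: (raddfB (mcoeff g)). Qed.

HB.instance Definition _ g :=
  GRing.isZmodMorphism.Build RG R (coeff g)
    (group_ring_coeff_is_zmod_morphism g).

Lemma group_ringE x : x = \sum_(g <- msupp x) mon g (coeff g x).
Proof. exact: monalgE. Qed.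

Lemma group_ring_mulEw (d1 d2 : {fset G}) x y :
  (msupp x `<=` d1)%fset -> (msupp y `<=` d2)%fset ->
  mul x y = \sum_(g <- d1) \sum_(h <- d2) mon (g * h)%g (coeff g x * coeff h y).
Proof.
move=> le1 le2; rewrite /mul (big_fset_incl _ le1) /=.
  apply/eq_bigr=> g _; apply/big_fset_incl => // h _ /mcoeff_outdom yh0.
  by rewrite /coeff yh0 mulr0 raddf0.
move=> g _ /mcoeff_outdom xg0.
by rewrite big1 // => h _; rewrite /coeff xg0 mul0r raddf0.
Qed.

Lemma group_ring_mulDl : left_distributive mul +%R.
Proof.
move=> x y z; pose d := (msupp x `|` msupp y `|` msupp (x + y : {malg R[G]}))%fset.
have [lx ly lxy] : [/\ (msupp x `<=` d)%fset, (msupp y `<=` d)%fset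
    & (msupp (x + y : {malg R[G]}) `<=` d)%fset].
  by split; apply/fsubsetP=> g gin; rewrite !in_fsetE gin ?orbT.
rewrite (group_ring_mulEw lx (fsubset_refl _)).
rewrite (group_ring_mulEw ly (fsubset_refl _)).
rewrite (group_ring_mulEw lxy (fsubset_refl _)).
rewrite -big_split; apply/eq_bigr=> g _; rewrite -big_split; apply/eq_bigr=> h _.
by rewrite raddfD /= mulrDl raddfD.
Qed.

Lemma group_ring_mulDr : right_distributive mul +%R.
Proof.
move=> z x y; pose d := (msupp x `|` msupp y `|` msupp (x + y : {malg R[G]}))%fset.
have [lx ly lxy] : [/\ (msupp x `<=` d)%fset, (msupp y `<=` d)%fset
    & (msupp (x + y : {malg R[G]}) `<=` d)%fset].
  by split; apply/fsubsetP=> g gin; rewrite !in_fsetE gin ?orbT.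
rewrite (group_ring_mulEw (fsubset_refl _) lx).
rewrite (group_ring_mulEw (fsubset_refl _) ly).
rewrite (group_ring_mulEw (fsubset_refl _) lxy).
rewrite -big_split; apply/eq_bigr=> g _; rewrite -big_split; apply/eq_bigr=> h _.
by rewrite raddfD /= mulrDr raddfD.
Qed.

Lemma group_ring_mul0l : left_zero 0 mul.
Proof.
by move=> x; apply: (addrI (mul 0 x)); rewrite -group_ring_mulDl !addr0.
Qed.

Lemma group_ring_mul0r : right_zero 0 mul.
Proof.
by move=> x; apply: (addrI (mul x 0)); rewrite -group_ring_mulDr !addr0.
Qed.

Lemma group_ring_mul_suml I (r : seq I) (F : I -> RG) y :
  mul (\sum_(i <- r) F i) y = \sum_(i <- r) mul (F i) y.
Proof.
apply: (big_morph (mul^~ y)) => [u v|]; first exact: group_ring_mulDl.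
exact: group_ring_mul0l.
Qed.

Lemma group_ring_mul_sumr I (r : seq I) (F : I -> RG) x :
  mul x (\sum_(i <- r) F i) = \sum_(i <- r) mul x (F i).
Proof.
apply: (big_morph (mul x)) => [u v|]; first exact: group_ring_mulDr.
exact: group_ring_mul0r.
Qed.

Lemma group_ring_mul_monomial g h c d :
  mul (mon g c) (mon h d) = mon (g * h)%g (c * d).
Proof.
rewrite (group_ring_mulEw msuppU_le msuppU_le) !big_seq_fset1.
by rewrite /coeff /mon !mcoeffUU.
Qed.

Lemma group_ring_mulA : associative mul.
Proof.
move=> x y z; rewrite [x]group_ringE [y]group_ringE [z]group_ringE.
rewrite !group_ring_mul_suml; apply: eq_bigr=> g _.
rewrite group_ring_mul_sumr (group_ring_mul_sumr (msupp y)) group_ring_mul_suml.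
apply: eq_bigr=> h _; rewrite !group_ring_mul_sumr; apply: eq_bigr=> k _.
by rewrite !group_ring_mul_monomial mulrA mulgA.
Qed.

Lemma group_ring_mul1l : left_id group_ring_one mul.
Proof.
move=> x; rewrite [in LHS](group_ringE x) group_ring_mul_sumr.
rewrite [RHS]group_ringE; apply/eq_bigr=> g _.
by rewrite group_ring_mul_monomial mul1r mul1g.
Qed.

Lemma group_ring_mul1r : right_id group_ring_one mul.
Proof.
move=> x; rewrite [in LHS](group_ringE x) group_ring_mul_suml.
rewrite [RHS]group_ringE; apply/eq_bigr=> g _.
by rewrite group_ring_mul_monomial mulr1 mulg1.
Qed.

HB.instance Definition _ := GRing.Zmodule_isPzRing.Build RG
  group_ring_mulA group_ring_mul1l group_ring_mul1r
  group_ring_mulDl group_ring_mulDr.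

Lemma group_ring_mulE x y : x * y =
  \sum_(g <- msupp x) \sum_(h <- msupp y) mon (g * h)%g (coeff g x * coeff h y).
Proof. by []. Qed.

Lemma group_ring_oneE : 1 = mon 1%g 1.
Proof. by []. Qed.

End GroupRing.

(* Main.v *)
Require Import Defs.
From HB Require Import structures.
From mathcomp Require Import all_boot all_algebra.
From mathcomp Require Import finfield.
From mathcomp Require Import finmap monalg.
From mathcomp Require Import boolp classical_sets cardinality.

(* Let J = J(R). Some positive integer N vanishes in R.

   The ring R/J is locally finite. Indeed 1 is a finite sum of elements of
   minimal left ideals S e of S = R/J, and x in S is determined by its action
   on these S e, which are finite-dimensional right vector spaces over the
   division rings e S e. The latter are periodic, hence commutative by
   Jacobson's theorem, so that finitely many matrix entries in e S e generate
   a finite subring.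

   Given x in RG, the support of x generates a finite subgroup and its
   coefficients modulo J lie in a finite subring, so x^m - x^n lies in JG for
   some 0 < m < n. By Koenig's lemma, T-nilpotence makes all long products of
   elements of a finite subset of J vanish, so x^m - x^n is nilpotent.
   Finally z (u - 1)^k = 0 and N = 0 imply z u^(N k!) = z, because N divides
   the binomials C(N k!, i) for 0 < i <= k; this applies to u = x^(n-m). *)

Set Implicit Arguments.
Unset Strict Implicit.
Unset Printing Implicit Defensive.

Import GRing.Theory.

Local Open Scope classical_set_scope.
Local Open Scope ring_scope.

Lemma finite_set_pigeonhole (T : eqType) (A : set T) (f : nat -> T) :
  finite_set A -> (forall n, A (f n)) ->
  exists m n : nat, (m < n)%N /\ f m = f n.
Proof.
move=> /finite_seqP[s defA] Af; apply: contrapT => inj_f.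
have uniq_f : uniq [seq f i | i <- iota 0 (size s).+1].
  rewrite map_inj_in_uniq ?iota_uniq // => i j _ _ eqf.
  by case: (ltngtP i j) => // ltij; case: inj_f; [exists i, j | exists j, i].
have /(uniq_leq_size uniq_f) : {subset [seq f i | i <- iota 0 (size s).+1] <= s}.
  by move=> _ /mapP[i _ ->]; have := Af i; rewrite defA.
by rewrite size_map size_iota ltnn.
Qed.

(* Closure under negation is omitted: in positive characteristic it follows
   from closure under addition. *)
Definition subrng (R : pzRingType) (T : set R) : Prop :=
  [/\ T 0, (forall x y, T x -> T y -> T (x + y))
    & (forall x y, T x -> T y -> T (x * y))].

Lemma subrng_sum (R : pzRingType) (T : set R) I (r : seq I) (P : pred I)
    (F : I -> R) : subrng T ->
  (forall i, P i -> T (F i)) -> T (\sum_(i <- r | P i) F i).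
Proof.
move=> [T0 TD _] TF; apply: (big_rec T) => // i x Pi Tx.
by apply: TD => //; apply: TF.
Qed.

Lemma finite_mul_closed_span (R : pzRingType) (N : nat) (s : seq R) :
  (0 < N)%N -> N%:R = 0 :> R ->
  (forall x y, x \in s -> y \in s -> x * y \in s) ->
  exists T : set R, [/\ finite_set T, subrng T & forall x, x \in s -> T x].
Proof.
move=> N_gt0 N0 sM.
pose F (f : nat -> nat) : R := \sum_(i < size s) s`_i *+ f i.
pose T := [set F f | f in [set: nat -> nat]].
have T0 : T 0 by exists (fun _ => 0%N) => //; rewrite /F big1.
have TD x y : T x -> T y -> T (x + y).
  move=> [f _ <-] [g _ <-]; exists (fun i => f i + g i)%N => //.
  by rewrite /F -big_split; apply: eq_bigr => i _; rewrite mulrnDr.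
have Ts x : x \in s -> T x.
  move=> xs; have idx : (index x s < size s)%N by rewrite index_mem.
  exists (fun i => (i == index x s) : nat) => //; rewrite /F.
  rewrite (bigD1 (Ordinal idx)) //= eqxx nth_index // big1 ?addr0 //.
  by move=> i /negPf; rewrite -val_eqE /= => ->.
have TMn x k : T x -> T (x *+ k).
  by move=> Tx; elim: k => [|k IHk]; rewrite ?mulr0n // mulrS; apply: TD.
exists T; split=> //.
  pose h (g : {ffun 'I_(size s) -> 'I_N}) : R := \sum_(i < size s) s`_i *+ g i.
  apply: (@sub_finite_set _ _ (h @` setT)); last first.
    by apply: finite_image; exact: finite_finset.
  move=> _ [f _ <-].
  exists [ffun i : 'I_(size s) => Ordinal (ltn_pmod (f i) N_gt0)] => //.
  apply: eq_bigr => i _; rewrite ffunE /= [in RHS](divn_eq (f i) N) mulrnDr.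
  by rewrite mulnC mulrnA -[s`_i *+ N]mulr_natr N0 mulr0 mul0rn add0r.
split=> // _ _ [f _ <-] [g _ <-]; rewrite /F mulr_suml.
apply: (big_rec T) => // i x _; apply/TD; rewrite mulr_sumr.
apply: (big_rec T) => // j y _; apply/TD; rewrite mulrnAl mulrnAr.
by do 2!apply/TMn; apply/Ts/sM; apply: mem_nth.
Qed.

Lemma periodic_ring_lt (R : pzRingType) (x : R) : periodic_ring R ->
  exists m n : nat, (0 < m < n)%N /\ x ^+ m = x ^+ n.
Proof.
move=> /(_ x)[m [n [m_gt0 n_gt0 neq_mn eqx]]].
by case: (ltngtP m n) => [lt|lt|//]; [exists m, n | exists n, m];
  rewrite ?m_gt0 ?n_gt0.
Qed.

Lemma periodic_ring_natr_eq0 (R : pzRingType) : periodic_ring R ->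
  exists N : nat, (0 < N)%N /\ N%:R = 0 :> R.
Proof.
move=> /(periodic_ring_lt 2%:R)[m [n [/andP[_ lt_mn] eq2]]].
exists (2 ^ n - 2 ^ m)%N; rewrite subn_gt0 ltn_exp2l //; split=> //.
rewrite natrB; last by rewrite leq_exp2l ?(ltnW lt_mn).
by rewrite !natrX eq2 subrr.
Qed.

Lemma expr_periodic_lt (R : pzRingType) (x : R) m n k : (m < n)%N ->
  x ^+ m = x ^+ n -> exists i : nat, (i < n)%N /\ x ^+ k = x ^+ i.
Proof.
move=> lt_mn eqx; elim/ltn_ind: k => k IHk.
have [ltkn|lenk] := ltnP k n; first by exists k.
have [|i [ltin eqi]] := IHk (k - (n - m))%N.
  rewrite ltn_subrL subn_gt0 lt_mn (leq_ltn_trans (leq0n m)) //.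
  exact: leq_trans lt_mn lenk.
exists i; split=> //; rewrite -eqi -{1}(subnK lenk) exprD -eqx -exprD.
congr (_ ^+ _).
by rewrite subnBA // 1?ltnW // addnBAC // addnC.
Qed.

Lemma commuting_periodic_span (R : pzRingType) (s : seq R) :
  periodic_ring R -> {in s &, forall x y, x * y = y * x} ->
  exists T : set R, [/\ finite_set T, subrng T & forall x, x \in s -> T x].
Proof.
move=> perR s_comm; have [N [N_gt0 N0]] := periodic_ring_natr_eq0 perR.
suff [M [M1 MM sM _]] : exists M : seq R, [/\ 1 \in M,
    (forall x y, x \in M -> y \in M -> x * y \in M), {subset s <= M}
    & (forall z, {in s, forall x, x * z = z * x} ->
         {in M, forall x, x * z = z * x})].
  have [T [finT sT MT]] := finite_mul_closed_span N_gt0 N0 MM.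
  by exists T; split=> // x /sM; apply: MT.
elim: s s_comm => [_|x s IHs s_comm].
  exists [:: 1]; split=> [|x y|//|z _ x]; rewrite ?mem_head // !inE.
    by move=> /eqP-> /eqP->; rewrite mulr1.
  by move=> /eqP->; rewrite mul1r mulr1.
have [|M [M1 MM sM centM]] := IHs.
  by move=> y z ys zs; apply: s_comm; rewrite inE ?ys ?zs orbT.
have [m [n [/andP[_ lt_mn] eqx]]] := periodic_ring_lt x perR.
have xM y : y \in M -> y * x = x * y.
  move=> yM; apply: centM => // z zs; apply: s_comm; rewrite inE ?zs ?orbT //.
  by rewrite eqxx.
have in_M' z k : z \in M ->
    z * x ^+ k \in [seq u * x ^+ i | u <- M, i <- iota 0 n].
  move=> zM; have [i [lt_in ->]] := expr_periodic_lt k lt_mn eqx.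
  by apply/allpairsP; exists (z, i); rewrite mem_iota.
exists [seq z * x ^+ i | z <- M, i <- iota 0 n]; split.
- by have := in_M' 1 0%N M1; rewrite expr0 mulr1.
- move=> _ _ /allpairsP[[y i] /= [yM _ ->]] /allpairsP[[z j] /= [zM _ ->]].
  have /(commrX i) czx : GRing.comm z x by apply: xM.
  by rewrite -mulrA [_ * (z * _)]mulrA -czx -mulrA -exprD mulrA in_M' ?MM.
- move=> y; rewrite inE => /orP[/eqP->|/sM yM].
    by have := in_M' 1 1%N M1; rewrite expr1 mul1r.
  by have := in_M' y 0%N yM; rewrite expr0 mulr1.
- move=> z zP _ /allpairsP[[y i] /= [yM _ ->]].
  have czx : GRing.comm z x by rewrite /GRing.comm zP ?mem_head.
  rewrite -mulrA -(commrX i czx) !mulrA; congr (_ * _).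
  by apply: centM => // t ts; apply: zP; rewrite inE ts orbT.
Qed.

Section SubringType.
Variables (D : nzRingType) (S : subringClosed D).

Definition subring_type : Type := {x : D | x \in S}.

HB.instance Definition _ := SubChoice.on subring_type.
HB.instance Definition _ :=
  [SubChoice_isSubNzRing of subring_type by <:].

End SubringType.

Lemma finite_subring_comm (D : nzRingType) (T : set D) :
  finite_set T -> T 1 -> (forall x y, T x -> T y -> T (x - y)) ->
  (forall x y, T x -> T y -> T (x * y)) ->
  (forall x y : D, x * y = 0 -> x = 0 \/ y = 0) ->
  forall x y, T x -> T y -> x * y = y * x.
Proof.
move=> /finite_seqP[s defT] T1 TB TM domD x y Tx Ty.
have closedT : GRing.subring_closed (mem s).
  by split; move: T1 TB TM; rewrite defT.
pose clP := GRing.isSubringClosed.Build D (fun x => x \in s) closedT.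
pose S : subringClosed D := HB.pack (fun x => x \in s) clP.
have inS z : (z \in S) = (z \in s) by [].
pose st := subring_type S.
have valP' (z : st) : val z \in s by rewrite -inS; apply: valP.
pose idx (z : st) : 'I_(size s) :=
  Ordinal (etrans (index_mem (val z) s) (valP' z)).
have idxK : pcancel idx (fun i => insub s`_i).
  by move=> z; rewrite /= nth_index ?valP' // valK.
pose ct := HB.pack_for countType st (PCanIsCountable idxK).
pose fct := @PCanIsFinite ct 'I_(size s) idx _ idxK.
pose ft := HB.pack_for finNzRingType st ct fct.
pose ut := HB.pack_for finUnitRingType ft (FinRing.isNzRing.Build ft).
have domU : GRing.integral_domain_axiom ut.
  move=> u v /(congr1 (fun w : st => val w)) /= => /domD[] w0.
    by apply/orP; left; apply/eqP/val_inj.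
  by apply/orP; right; apply/eqP/val_inj.
have [xS yS] : x \in S /\ y \in S by move: Tx Ty; rewrite defT.
have /(congr1 (fun w : st => val w)) :=
  finDomain_mulrC domU (Sub x xS : st) (Sub y yS : st).
by [].
Qed.

Section TorsionDivisionRing.
Variable D : nzRingType.
Hypothesis torsionD : forall x : D, x != 0 -> exists2 k, (0 < k)%N & x ^+ k = 1.

Lemma torsion_domain (x y : D) : x * y = 0 -> x = 0 \/ y = 0.
Proof.
move=> xy0; have [->|/torsionD[k k_gt0 xk1]] := eqVneq x 0; first by left.
by right; rewrite -[y]mul1r -xk1 -(prednK k_gt0) exprSr -mulrA xy0 mulr0.
Qed.

Lemma torsion_expr_eq0 (x : D) n : x ^+ n = 0 -> x = 0.
Proof.
elim: n => [/eqP|n IHn]; first by rewrite expr0 oner_eq0.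
by rewrite exprS => /torsion_domain[].
Qed.

Lemma torsion_mulIr (x y z : D) : z != 0 -> x * z = y * z -> x = y.
Proof.
move=> z0 /eqP; rewrite -subr_eq0 -mulrBl => /eqP/torsion_domain[/eqP|/eqP].
  by rewrite subr_eq0 => /eqP.
by rewrite (negPf z0).
Qed.

Lemma torsion_periodic : periodic_ring D.
Proof.
move=> x; have [->|/torsionD[k k_gt0 xk1]] := eqVneq x 0.
  by exists 1%N, 2%N; rewrite expr1 expr0n.
exists 1%N, k.+1; split=> //; first by case: k k_gt0 {xk1}.
by rewrite expr1 exprS xk1 mulr1.
Qed.

Lemma natr_eq0_prime_dvd k : (0 < k)%N -> k%:R = 0 :> D ->
  exists p : nat, [/\ prime p, (p %| k)%N & p%:R = 0 :> D].
Proof.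
elim/ltn_ind: k => k IHk k_gt0 k0.
have [k1|k_neq1] := eqVneq k 1%N.
  by have := oner_eq0 D; rewrite -k0 k1 eqxx.
have k_gt1 : (1 < k)%N by rewrite ltn_neqAle eq_sym k_neq1.
have := k0; rewrite -{1}(divnK (pdiv_dvd k)) natrM => /torsion_domain[q0|p0].
  have [||//|p [p_pr p_dvd p0]] := IHk (k %/ pdiv k)%N.
  - by rewrite ltn_Pdiv ?prime_gt1 ?pdiv_prime.
  - by rewrite divn_gt0 ?pdiv_gt0 // dvdn_leq // pdiv_dvd.
  by exists p; split=> //; apply: dvdn_trans p_dvd (dvdn_div (pdiv_dvd k)).
by exists (pdiv k); rewrite pdiv_prime ?pdiv_dvd.
Qed.

Variables (a : D) (k : nat).
Hypotheses (k_gt0 : (0 < k)%N) (ak1 : a ^+ k = 1).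
Hypothesis min_k : forall i, (0 < i < k)%N -> a ^+ i != 1.

Lemma torsion_order_neq0 : k%:R != 0 :> D.
Proof.
apply/eqP => /(natr_eq0_prime_dvd k_gt0)[p [p_pr p_dvd p0]].
have pcharp : p \in [pchar D] by apply/andP; split=> //; apply/eqP.
have : (a ^+ (k %/ p) - 1) ^+ p = 0.
  have := pFrobenius_autB_comm pcharp (commr1 (a ^+ (k %/ p))).
  by rewrite !pFrobenius_autE -exprM divnK // ak1 expr1n subrr.
move/torsion_expr_eq0/eqP; rewrite subr_eq0; apply/negP/min_k.
by rewrite divn_gt0 ?prime_gt0 // dvdn_leq //= ltn_Pdiv ?prime_gt1.
Qed.

Let a' := a ^+ k.-1.

Let aa' : a * a' = 1. Proof. by rewrite /a' -exprS prednK. Qed.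
Let a'a : a' * a = 1. Proof. by rewrite /a' -exprSr prednK. Qed.

(* The component of [x] in the eigenspace of conjugation by [a] for the
   eigenvalue [a ^+ j], scaled by [k]. *)
Let F j (x : D) t := a' ^+ (j * t) * (a ^+ t * x * a' ^+ t).
Let P j x := \sum_(t < k) F j x t.

Let a'k : a' ^+ k = 1.
Proof. by rewrite /a' -exprM mulnC exprM ak1 expr1n. Qed.

Let commaa' : GRing.comm a a'. Proof. by rewrite /GRing.comm aa' a'a. Qed.

Lemma eigen_conj j x : a * P j x = a ^+ j * P j x * a.
Proof.
have FS t : a * F j x t = a ^+ j * F j x t.+1 * a.
  rewrite /F mulnS exprD !mulrA -exprMn_comm // aa' expr1n mul1r.
  rewrite (commrX _ commaa') -[RHS]mulrA [a' ^+ t.+1]exprSr.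
  rewrite -[X in _ = _ * X]mulrA.
  by rewrite a'a mulr1 exprS !mulrA.
have F0 : F j x k = F j x 0%N.
  by rewrite /F muln0 mulnC exprM ak1 a'k expr1n !expr0.
rewrite /P mulr_sumr mulr_sumr mulr_suml; under eq_bigr do rewrite FS.
case: (k) k_gt0 F0 => // n _ F0.
by rewrite big_ord_recr [RHS]big_ord_recl /= F0 addrC.
Qed.

Lemma sum_eigen x : \sum_(j < k) P j x = x *+ k.
Proof.
rewrite /P exchange_big /= (bigD1 (Ordinal k_gt0)) //= [X in _ + X]big1 ?addr0.
  under eq_bigr do rewrite /F muln0 !expr0 mul1r mulr1 mul1r.
  by rewrite sumr_const card_ord.
move=> t t_neq0; rewrite /F -mulr_suml; under eq_bigr do rewrite mulnC exprM.
have /torsion_domain[/eqP|->] : (a' ^+ t - 1) * \sum_(j < k) (a' ^+ t) ^+ j = 0.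
- by rewrite -subrX1 -exprM mulnC exprM a'k expr1n subrr.
- rewrite subr_eq0 => /eqP a't1; have /negP[] : a ^+ t != 1.
    by apply: min_k; rewrite ltn_ord andbT lt0n -(inj_eq val_inj) in t_neq0 *.
  by apply/eqP; rewrite -[RHS](expr1n _ t) -aa' exprMn_comm // a't1 mulr1.
- by rewrite mul0r.
Qed.

Lemma torsion_normalizing b : a * b != b * a ->
  exists c, exists s : nat, [/\ c != 0, c * a = a ^+ s * c & c * a != a * c].
Proof.
move=> ab; have [j [j_gt0 Pj0]] : exists j : 'I_k, (0 < j)%N /\ P j b != 0.
  apply: contrapT => P0; case/eqP: ab.
  have := sum_eigen b; rewrite (bigD1 (Ordinal k_gt0)) //= big1 ?addr0 => [PE|j].
    have := eigen_conj 0 b; rewrite expr0 mul1r PE mulrnAr mulrnAl.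
    by rewrite -[LHS]mulr_natr -[RHS]mulr_natr => /(torsion_mulIr torsion_order_neq0).
  rewrite -(inj_eq val_inj) /= -lt0n => j_gt0; apply/eqP/negPn/negP => Pj0.
  by apply: P0; exists j.
have cE := eigen_conj j b; exists (P j b), (k - j + 1)%N.
have jk := ltnW (ltn_ord j).
have ca : P j b * a = a ^+ (k - j + 1) * P j b.
  rewrite exprD expr1 -mulrA cE !mulrA -exprD subnK //.
  by rewrite ak1 mul1r.
split=> //; apply/eqP => caC; have /negP[] : a ^+ (k - j) != 1.
  by apply: min_k; rewrite subn_gt0 ltn_ord ltn_subrL j_gt0.
have acN0 : a * P j b != 0.
  by apply: contraNneq Pj0 => ac0; rewrite -[P j b]mul1r -a'a -mulrA ac0 mulr0.
apply/eqP/(torsion_mulIr acN0).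
by rewrite mul1r mulrA -exprSr -addn1 -ca caC.
Qed.

End TorsionDivisionRing.

Lemma subrng_opp (R : pzRingType) (N : nat) (T : set R) : (0 < N)%N ->
  N%:R = 0 :> R -> subrng T -> forall x, T x -> T (- x).
Proof.
move=> N_gt0 N0 [T0 TD _] x Tx.
have -> : - x = x *+ N.-1.
  apply/eqP; rewrite eq_sym -addr_eq0 -mulrSr prednK //.
  by rewrite -[x *+ N]mulr_natr N0 mulr0.
by elim: N.-1 => [|n IHn]; rewrite ?mulr0n // mulrS; apply: TD.
Qed.

(* The argument of Jacobson: if [a] is not central, then some [c] outside the
   centraliser of [a] normalises the group generated by [a], so [a] and [c]
   generate a finite ring, which is commutative by Wedderburn's theorem. *)
Lemma torsion_division_ring_comm (D : nzRingType) :
  (forall x : D, x != 0 -> exists2 k, (0 < k)%N & x ^+ k = 1) ->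
  forall x y : D, x * y = y * x.
Proof.
move=> torsionD a b; apply: contrapT => /eqP ab.
have a0 : a != 0 by apply: contraNneq ab => ->; rewrite mul0r mulr0.
have ex_k : exists k, (0 < k)%N && (a ^+ k == 1).
  by have [k k_gt0 ak1] := torsionD a a0; exists k; rewrite k_gt0 ak1 /=.
case: (ex_minnP ex_k) => k /andP[k_gt0 /eqP ak1] min_k.
have min_k' i : (0 < i < k)%N -> a ^+ i != 1.
  move=> /andP[i_gt0 lt_ik]; apply: contraL lt_ik => ai1.
  by rewrite -leqNgt min_k // i_gt0.
have [c [s [c0 ca /eqP[]]]] := torsion_normalizing torsionD k_gt0 ak1 min_k' ab.
have [l l_gt0 cl1] := torsionD c c0.
have [N [N_gt0 N0]] := periodic_ring_natr_eq0 (torsion_periodic torsionD).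
pose M := [seq a ^+ i * c ^+ j | i <- iota 0 k, j <- iota 0 l].
have in_M i j : a ^+ i * c ^+ j \in M.
  apply/allpairsP; exists ((i %% k)%N, (j %% l)%N).
  by rewrite !mem_iota !ltn_pmod //= !expr_mod.
have conj_c i j : c ^+ j * a ^+ i = a ^+ (s ^ j * i) * c ^+ j.
  have conj1 n : c * a ^+ n = a ^+ (s * n) * c.
    elim: n => [|n IHn]; first by rewrite muln0 !expr0 mulr1 mul1r.
    by rewrite exprSr mulrA IHn -mulrA ca mulrA -exprD mulnSr.
  elim: j => [|j IHj]; first by rewrite !expr0 mul1r mul1n mulr1.
  by rewrite exprS -mulrA IHj mulrA conj1 -mulrA expnS mulnA.
have MM x y : x \in M -> y \in M -> x * y \in M.
  move=> /allpairsP[[i j] /= [_ _ ->]] /allpairsP[[i' j'] /= [_ _ ->]].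
  by rewrite -mulrA [c ^+ j * _]mulrA conj_c -mulrA -exprD mulrA -exprD.
have [T [finT subT MT]] := finite_mul_closed_span N_gt0 N0 MM.
have [T0 TD TM] := subT.
apply: (finite_subring_comm finT) => //.
- by have := MT _ (in_M 0 0)%N; rewrite !expr0 mulr1.
- by move=> x y Tx Ty; apply: TD => //; apply: (subrng_opp N_gt0 N0).
- by move=> x y; apply: torsion_domain.
- by have := MT _ (in_M 0 1)%N; rewrite expr0 mul1r.
- by have := MT _ (in_M 1 0)%N; rewrite expr0 mulr1.
Qed.

Section Corner.
Variables (R : pzRingType) (e : R).
Hypotheses (idem_e : e * e = e) (e_neq0 : e != 0).

Definition corner_pred : {pred R} := [pred x | e * x * e == x].

Lemma corner_zmod_closed : zmod_closed corner_pred.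
Proof.
split=> [|x y]; rewrite !inE ?mulr0 ?mul0r // => /eqP xE /eqP yE.
by rewrite mulrBr mulrBl xE yE.
Qed.

HB.instance Definition _ :=
  GRing.isZmodClosed.Build R corner_pred corner_zmod_closed.

(* The vacuous [let] makes the type depend on the hypotheses on [e], which its
   ring structure needs. *)
Definition corner : Type :=
  let: _ := (idem_e, e_neq0) in {x : R | x \in corner_pred}.

HB.instance Definition _ := SubChoice.on corner.
HB.instance Definition _ := [SubChoice_isSubZmodule of corner by <:].

Lemma cornerE x : x \in corner_pred -> e * x * e = x.
Proof. by rewrite inE => /eqP. Qed.

Lemma corner_mull x : x \in corner_pred -> e * x = x.
Proof. by move=> /cornerE xE; rewrite -{1}xE !mulrA idem_e. Qed.

Lemma corner_mulr x : x \in corner_pred -> x * e = x.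
Proof. by move=> /cornerE xE; rewrite -{1}xE -!mulrA idem_e mulrA. Qed.

Lemma corner_id : e \in corner_pred.
Proof. by rewrite inE !idem_e. Qed.

Lemma corner_predM x y : x \in corner_pred -> y \in corner_pred ->
  x * y \in corner_pred.
Proof. by move=> Cx Cy; rewrite inE mulrA corner_mull // -mulrA corner_mulr. Qed.

Definition corner_one : corner := Sub e corner_id.
Definition corner_mul (x y : corner) : corner :=
  Sub (val x * val y) (corner_predM (valP x) (valP y)).

Lemma corner_mulA : associative corner_mul.
Proof. by move=> x y z; apply: val_inj; rewrite /= mulrA. Qed.
Lemma corner_mul1l : left_id corner_one corner_mul.
Proof. by move=> x; apply: val_inj; apply: corner_mull (valP x). Qed.
Lemma corner_mul1r : right_id corner_one corner_mul.
Proof. by move=> x; apply: val_inj; apply: corner_mulr (valP x). Qed.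
Lemma corner_mulDl : left_distributive corner_mul +%R.
Proof. by move=> x y z; apply: val_inj; rewrite /= mulrDl. Qed.
Lemma corner_mulDr : right_distributive corner_mul +%R.
Proof. by move=> x y z; apply: val_inj; rewrite /= mulrDr. Qed.
Lemma corner_one_neq0 : corner_one != 0.
Proof. by rewrite -(inj_eq val_inj). Qed.

HB.instance Definition _ := GRing.Zmodule_isNzRing.Build corner
  corner_mulA corner_mul1l corner_mul1r corner_mulDl corner_mulDr
  corner_one_neq0.

Lemma corner_valM (x y : corner) : val (x * y) = val x * val y.
Proof. by []. Qed.

Lemma corner_valX (x : corner) n : (0 < n)%N -> val (x ^+ n) = val x ^+ n.
Proof.
case: n => // n _; elim: n => [|n IHn]; first by rewrite !expr1.
by rewrite exprS corner_valM IHn -exprS.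
Qed.

Lemma corner_comm : periodic_ring R ->
  (forall x, e * x * e = x -> x != 0 -> exists w, w * x = e) ->
  forall x y, e * x * e = x -> e * y * e = y -> x * y = y * x.
Proof.
move=> perR invR x y xE yE.
suff cornC : forall u v : corner, u * v = v * u.
  have Cx : x \in corner_pred by apply/eqP.
  have Cy : y \in corner_pred by apply/eqP.
  exact: (congr1 (fun z : corner => val z) (cornC (Sub x Cx) (Sub y Cy))).
apply: torsion_division_ring_comm => u u0.
have [w wu] : exists w : corner, w * u = 1.
  have [//|w wu] := invR (val u) (cornerE (valP u)).
  have Cw : e * w * e \in corner_pred by rewrite inE !mulrA idem_e -!mulrA idem_e.
  exists (Sub (e * w * e) Cw); apply: val_inj.
  by rewrite corner_valM SubK -mulrA (corner_mull (valP u)) -mulrA wu idem_e.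
have [m [n [/andP[m_gt0 lt_mn] uX]]] := periodic_ring_lt (val u) perR.
have {}uX : u ^+ m = u ^+ n.
  by apply: val_inj; rewrite !corner_valX // (leq_trans m_gt0) // ltnW.
exists (n - m)%N; first by rewrite subn_gt0.
have wX i : w ^+ i * u ^+ i = 1.
  elim: i => [|i IHi]; first by rewrite !expr0 mulr1.
  by rewrite exprSr exprS mulrA -[_ * w * u]mulrA wu mulr1.
by rewrite -[LHS]mul1r -(wX m) -mulrA -exprD subnKC ?(ltnW lt_mn) // -uX.
Qed.

End Corner.

Section Semisimple.
Variable S : pzRingType.
Implicit Types (x y e : S) (L M N : set S).

Definition minimal_left_ideal L : Prop :=
  [/\ left_ideal L, L <> [set 0]
    & forall N, left_ideal N -> N `<=` L -> N = [set 0] \/ N = L].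

(* [S e] is a minimal left ideal. *)
Definition minimal_idem e : Prop :=
  [/\ e * e = e, e != 0
    & forall x, x * e = x -> x != 0 -> exists w, w * x = e].

Lemma minimal_left_ideal_idem L : semisimple_ring S -> minimal_left_ideal L ->
  exists e, L e /\ minimal_idem e.
Proof.
move=> ssS [idL /eqP L_neq0 minL]; have [L0 LB LM] := idL.
have [K [[K0 KB KM] LK0 LKT]] := ssS L idL.
have [e [z [Le Kz e1]]] := LKT 1.
have Le_id x : L x -> x * e = x.
  move=> Lx; have xE : x * z = x - x * e.
    by apply/eqP; rewrite eq_sym subr_eq -mulrDr [z + e]addrC -e1 mulr1.
  have : (L `&` K) (x * z) by split; [rewrite xE; apply: LB (LM _ _ _)|apply: KM].
  by rewrite LK0 xE => /eqP; rewrite subr_eq0 => /eqP.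
have e_neq0 : e != 0.
  apply: contraNneq L_neq0 => e0; apply/eqP/seteqP; split=> x; last by move=> ->.
  by move=> /Le_id <-; rewrite e0 mulr0.
exists e; split=> //; split=> // [|x xe x0]; first exact: Le_id.
have idSx : left_ideal [set w * x | w in setT].
  split=> [|_ _ [v _ <-] [w _ <-]|v _ [w _ <-]].
  - by exists 0; rewrite ?mul0r.
  - by exists (v - w); rewrite ?mulrBl.
  - by exists (v * w); rewrite ?mulrA.
have Sx_x : [set w * x | w in setT] x by exists 1; rewrite ?mul1r.
have [|Sx|SxL] := minL _ idSx.
- by move=> _ [w _ <-]; apply: (LM); rewrite -xe; apply: LM.
- by move: Sx_x; rewrite Sx => /eqP; rewrite (negPf x0).
- by move: Le; rewrite -SxL => -[w _ <-]; exists w.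
Qed.

Lemma exists_maximal_left_ideal L : left_ideal L -> ~ L 1 ->
  exists M, maximal_left_ideal M /\ L `<=` M.
Proof.
move=> idL L1; pose P A := left_ideal (L `|` A) /\ ~ (L `|` A) 1.
have [F FP totF|A [[idA A1] maxA]] := @Zorn_bigcup _ P.
  split; last by move=> [//|[X FX X1]]; case: (FP X FX) => _; apply; right.
  have sub X : F X -> L `|` X `<=` L `|` \bigcup_(Y in F) Y.
    by move=> FX x [Lx|Xx]; [left|right; exists X].
  have [L0 LB LM] := idL; split=> [|x y Lx Ly|a x Lx]; first by left.
  - have in2 X : F X -> (L `|` X) x -> (L `|` X) y ->
        (L `|` \bigcup_(Y in F) Y) (x - y).
      move=> FX Xx Xy; apply: (sub X) => //.
      by case: (FP X FX) => -[_ XB _] _; apply: XB.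
    case: Lx Ly => [Lx|[X FX Xx]] [Ly|[Y FY Yy]].
    + by left; apply: LB.
    + by apply: (in2 Y) => //; [left|right].
    + by apply: (in2 X) => //; [right|left].
    + have [XY|YX] := totF X Y FX FY.
        by apply: (in2 Y) => //; right=> //; apply: XY.
      by apply: (in2 X) => //; right=> //; apply: YX.
  - case: Lx => [Lx|[X FX Xx]]; first by left; apply: LM.
    by apply: (sub X) => //; case: (FP X FX) => -[_ _ XM] _; apply: XM; right.
exists (L `|` A); split; last by move=> x; left.
split=> // [AT|N idN sAN]; first by apply: A1; rewrite AT.
have LN : L `|` N = N.
  by apply/seteqP; split=> x; [case=> // Lx; apply: sAN; left|right].
have [N1|N1] := pselect (N 1).
  right; apply/seteqP; split=> // x _; rewrite -[x]mulr1.
  by case: idN => _ _; apply.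
left; apply/seteqP; split=> //; apply: contrapT => NA.
apply: (maxA N); last by rewrite /P LN.
split; last by move=> AN; apply: NA => x Nx; right; apply: AN.
by move=> x Ax; apply: sAN; right.
Qed.

Lemma complement_maximal_left_ideal M K : maximal_left_ideal M ->
  left_ideal K -> M `&` K = [set 0] ->
  (forall x, exists y z, [/\ M y, K z & x = y + z]) -> minimal_left_ideal K.
Proof.
move=> [idM M_neqT maxM] idK MK0 MKT; have [[M0 MB MM] [K0 KB KM]] := (idM, idK).
split=> // [K_eq0|N idN sNK].
  apply: M_neqT; apply/seteqP; split=> // x _.
  by have [y [z [My]]] := MKT x; rewrite K_eq0 => -> ->; rewrite addr0.
have [N0 NB NM] := idN.
pose MN := [set x | exists y z, [/\ M y, N z & x = y + z]].
have idMN : left_ideal MN.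
  split=> [|_ _ [y [z [My Nz ->]]] [y' [z' [My' Nz' ->]]]|a _ [y [z [My Nz ->]]]].
  - by exists 0, 0; rewrite addr0.
  - exists (y - y'), (z - z'); rewrite opprD addrACA.
    by split; [exact: MB|exact: NB|].
  - by exists (a * y), (a * z); rewrite mulrDr; split; [exact: MM|exact: NM|].
have [|eqM|eqT] := maxM MN idMN.
- by move=> x Mx; exists x, 0; rewrite addr0.
- left; apply/seteqP; split=> x; last by move=> ->.
  move=> Nx; rewrite -MK0; split; last exact: sNK.
  by rewrite -eqM; exists 0, x; rewrite add0r.
right; apply/seteqP; split=> // x Kx.
have [y [z [My Nz xE]]] : MN x by rewrite eqT.
have : (M `&` K) y.
  by split=> //; rewrite -[y](addrK z) -xE; apply: KB => //; apply: sNK.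
by rewrite MK0 => y0; rewrite xE y0 add0r.
Qed.

Lemma semisimple_sum_minimal_idem : semisimple_ring S ->
  exists r : seq (S * S),
    (forall p, p \in r -> minimal_idem p.2 /\ p.1 * p.2 = p.1) /\
    1 = \sum_(p <- r) p.1.
Proof.
move=> ssS; pose ok (r : seq (S * S)) :=
  forall p, p \in r -> minimal_idem p.2 /\ p.1 * p.2 = p.1.
pose soc := [set x | exists r, ok r /\ x = \sum_(p <- r) p.1].
suff [r [okr E]] : soc 1 by exists r.
have socM a x : soc x -> soc (a * x).
  move=> [r [okr ->]]; exists [seq (a * p.1, p.2) | p <- r].
  split; last by rewrite big_map mulr_sumr.
  by move=> _ /mapP[p /okr[e_min pE] ->]; rewrite /= -mulrA pE.
have id_soc : left_ideal soc.
  split=> [|x y [r [okr ->]] /(socM (-1))[r' [okr' y'E]]|]; last exact: socM.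
    by exists [::]; rewrite big_nil.
  exists (r ++ r'); rewrite big_cat /= -y'E mulN1r; split=> // p.
  by rewrite mem_cat => /orP[/okr|/okr'].
apply: contrapT => /(exists_maximal_left_ideal id_soc)[M [maxM socM']].
have [idM _ _] := maxM; have [K [idK MK0 MKT]] := ssS M idM.
have [e [Ke e_min]] := minimal_left_ideal_idem ssS
  (complement_maximal_left_ideal maxM idK MK0 MKT).
have [ee /negP e0 _] := e_min; apply: e0; apply/eqP.
suff : (M `&` K) e by rewrite MK0.
split=> //; apply: socM'; exists [:: (e, e)]; rewrite big_seq1; split=> // p.
by rewrite inE => /eqP ->; split.
Qed.

Lemma minimal_idem_factor e e' a : minimal_idem e -> minimal_idem e' ->
  a * e' = a -> exists fu : S * S, [/\ fu.1 * e = fu.1, e * fu.2 = fu.2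
    & forall y, y * e = y -> a * y = fu.1 * fu.2 * y].
Proof.
move=> [ee e0 minE] [ee' e0' minE'] ae'.
have [[v [e'v ve v0]]|nov] := pselect (exists v,
  [/\ e' * v = v, v * e = v & v != 0]).
  have [w wv] := minE v ve v0; pose u := e * w * e'.
  have uv : u * v = e by rewrite /u -!mulrA e'v wv ee.
  have eu : e * u = u by rewrite /u !mulrA ee.
  have pp : v * u * (v * u) = v * u by rewrite -mulrA [u * _]mulrA uv eu.
  have pe' : v * u * e' = v * u by rewrite /u -!mulrA ee'.
  have p0 : v * u != 0.
    by apply: contraNneq v0 => p0; rewrite -ve -uv mulrA p0 mul0r.
  have [w' w'p] := minE' _ pe' p0.
  have pE : v * u = e' by rewrite -[RHS]w'p -[in RHS]pp [RHS]mulrA w'p mulrA e'v.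
  exists (a * v, u); split=> //= [|y _]; first by rewrite -mulrA ve.
  by rewrite -[a * v * u]mulrA pE ae'.
exists (0, 0); rewrite /= !mul0r mulr0; split=> // y ye.
rewrite mul0r -ae' -mulrA; suff -> : e' * y = 0 by rewrite mulr0.
apply/eqP/negPn/negP => e'y0; case: nov; exists (e' * y).
by rewrite mulrA ee' -mulrA ye.
Qed.

Lemma finite_set_sum (I : eqType) (r : seq I) (G : I -> set S) :
  (forall i, i \in r -> finite_set (G i)) ->
  finite_set [set x | exists2 g, (forall i, i \in r -> G i (g i))
                               & x = \sum_(i <- r) g i].
Proof.
elim: r => [_|i r IHr finG].
  by apply: (sub_finite_set _ (finite_set1 0)) => _ [g _ ->]; rewrite big_nil.
have finGi : finite_set (G i) by apply: finG; rewrite mem_head.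
have {}/IHr finGr : forall j, j \in r -> finite_set (G j).
  by move=> j jr; apply: finG; rewrite inE jr orbT.
apply: (sub_finite_set _ (finite_image (fun z => z.1 + z.2)
  (finite_setX finGi finGr))) => _ [g Gg ->].
rewrite big_cons; exists (g i, \sum_(j <- r) g j) => //; split=> /=.
  by apply: Gg; rewrite mem_head.
by exists g => // j jr; apply: Gg; rewrite inE jr orbT.
Qed.

(* Right multiplication by [e] makes [S e] a vector space over [e S e], and
   [T] consists of the elements of [S] whose matrix in a given basis of
   [S e] has entries in a finite subring of [e S e]. *)
Lemma minimal_idem_subrng (r : seq (S * S)) (s : seq S) e a :
  periodic_ring S ->
  (forall p, p \in r -> minimal_idem p.2 /\ p.1 * p.2 = p.1) ->
  1 = \sum_(p <- r) p.1 -> minimal_idem e -> a * e = a ->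
  exists T, [/\ subrng T, forall x, x \in s -> T x
    & finite_set [set x * a | x in T]].
Proof.
move=> perS okr r1 e_min ae; have [ee e0 minE] := e_min.
have /choice[F FP] : forall p, exists fu : S * S, p \in r ->
    [/\ fu.1 * e = fu.1, e * fu.2 = fu.2
      & forall y, y * e = y -> p.1 * y = fu.1 * fu.2 * y].
  move=> p; have [/okr[p_min pE]|] := boolP (p \in r); last by exists (0, 0).
  by have [fu fuP] := minimal_idem_factor e_min p_min pE; exists fu.
pose f p := (F p).1; pose u p := (F p).2.
have fe p : p \in r -> f p * e = f p by move=> /FP[].
have eu p : p \in r -> e * u p = u p by move=> /FP[].
have basis y : y * e = y -> y = \sum_(p <- r) f p * (u p * y).
  move=> ye; rewrite -[LHS]mul1r r1 mulr_suml !big_seq; apply: eq_bigr => p.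
  by rewrite mulrA => /FP[_ _ ->].
pose s' := [seq u z.2 * x * f z.1 | x <- s, z <- [seq (p, q) | p <- r, q <- r]].
have s'_comm : {in s' &, forall x y, x * y = y * x}.
  have s'E x : x \in s' -> e * x * e = x.
    move=> /allpairsP[[y z] /= [_ /allpairsP[[p q] /= [pr qr ->]] ->]] /=.
    by rewrite -!mulrA fe // !mulrA eu.
  move=> x y /s'E xE /s'E yE; apply: (corner_comm ee e0) => // z zE.
  by apply: minE; rewrite -zE -mulrA ee.
have [F0 [finF subF sF]] := commuting_periodic_span perS s'_comm.
have [F00 FD FM] := subF.
pose T := [set x | forall p q, p \in r -> q \in r -> F0 (u q * x * f p)].
exists T; split.
- split=> [p q _ _|x y Tx Ty p q pr qr|x y Tx Ty p q pr qr].
  + by rewrite mulr0 mul0r.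
  + by rewrite mulrDr mulrDl; apply: FD; [exact: Tx|exact: Ty].
  + rewrite mulrA -mulrA (basis (y * f p)) -?mulrA ?fe // !mulr_sumr.
    rewrite big_seq; apply: (@subrng_sum _ F0) => // t tr.
    by have := FM _ _ (Tx t q tr qr) (Ty p t pr tr); rewrite !mulrA.
- move=> x xs p q pr qr; apply/sF/allpairsP; exists (x, (p, q)); split=> //.
  by apply/allpairsP; exists (p, q).
pose G (z : S * S * (S * S)) := [set f z.2 * (c * (u z.1 * a)) | c in F0].
have finG z : z \in [seq (p, q) | p <- r, q <- r] -> finite_set (G z).
  by move=> _; apply: finite_image.
apply: (sub_finite_set _ (finite_set_sum finG)) => _ [x Tx <-].
exists (fun z => f z.2 * (u z.2 * x * f z.1 * (u z.1 * a))).
  move=> _ /allpairsP[[p q] /= [pr qr ->]].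
  by exists (u q * x * f p) => //; apply: Tx.
rewrite big_allpairs /= [in LHS](basis a) // mulr_sumr; apply: eq_bigr => p _.
rewrite [LHS]basis; last by rewrite -!mulrA ae.
by apply: eq_bigr => q _; rewrite !mulrA.
Qed.

Lemma semisimple_periodic_locally_finite (s : seq S) :
  semisimple_ring S -> periodic_ring S ->
  exists T, [/\ finite_set T, subrng T & forall x, x \in s -> T x].
Proof.
move=> ssS perS; have [r [okr r1]] := semisimple_sum_minimal_idem ssS.
have /choice[T TP] : forall p, exists T, p \in r -> [/\ subrng T,
    forall x, x \in s -> T x & finite_set [set x * p.1 | x in T]].
  move=> p; have [/okr[p_min pE]|] := boolP (p \in r); last by exists set0.
  by have [T TP] := minimal_idem_subrng s perS okr r1 p_min pE; exists T.
exists [set x | forall p, p \in r -> T p x]; split.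
- apply: (sub_finite_set _ (@finite_set_sum _ r
    (fun p => [set x * p.1 | x in T p]) _)) => [x Tx|p /TP[]//].
  exists (fun p => x * p.1); last by rewrite -mulr_sumr -r1 mulr1.
  by move=> p pr; exists x => //; apply: Tx.
- split=> [p /TP[[]]//|x y Tx Ty p pr|x y Tx Ty p pr].
  + by have [[_ TD _] _ _] := TP p pr; apply: TD; [exact: Tx|exact: Ty].
  + by have [[_ _ TM] _ _] := TP p pr; apply: TM; [exact: Tx|exact: Ty].
- by move=> x xs p /TP[_ sT _]; apply: sT.
Qed.

End Semisimple.

(* Koenig's lemma for words over a finite alphabet. *)
Lemma foldl_eq0_bounded (R : pzRingType) (op : R -> R -> R) (C : seq R) :
  (forall c, op 0 c = 0) ->
  (forall a : nat -> R, (forall i, a i \in C) ->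
     exists k, foldl op 1 (mkseq a k) = 0) ->
  exists k, forall w, {subset w <= C} -> size w = k -> foldl op 1 w = 0.
Proof.
move=> op0 seq0; apply: contrapT => no_bound.
have foldl0 w : foldl op 0 w = 0 by elim: w => //= c w; rewrite op0.
pose alive v := forall k, exists w,
  [/\ {subset w <= C}, size w = k & foldl op v w <> 0].
have alive1 : alive 1.
  move=> k; apply: contrapT => no_w; apply: no_bound; exists k => w wC wk.
  by apply: contrapT => w0; apply: no_w; exists w.
have /choice[F FP] : forall v, exists c, alive v -> c \in C /\ alive (op v c).
  move=> v; have [al|] := pselect (alive v); last by exists 0.
  apply: contrapT => no_c.
  have /choice[K KP] : forall c, exists k, c \in C ->
      forall w, {subset w <= C} -> size w = k -> foldl op (op v c) w = 0.
    move=> c; have [cC|] := boolP (c \in C); last by exists 0%N.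
    apply: contrapT => no_k; apply: no_c; exists c => _; split=> // k.
    apply: contrapT => no_w; apply: no_k; exists k => _ w wC wk.
    by apply: contrapT => w0; apply: no_w; exists w.
  have [[|c w] [wC // [wk]]] := al (\max_(c <- C) K c).+1.
  case; have cC : c \in C by apply: wC; rewrite mem_head.
  have Kc : (K c <= size w)%N by rewrite wk; apply: leq_bigmax_seq.
  rewrite /= -(cat_take_drop (K c) w) foldl_cat (KP c cC) ?foldl0 //.
    by move=> d /mem_take dw; apply: wC; rewrite inE dw orbT.
  by rewrite size_takel.
pose p := fix p n := if n is n'.+1 then op (p n') (F (p n')) else 1.
have alive_p n : alive (p n).
  by elim: n => //= n IHn; have [] := FP _ IHn.
have [i|k] := seq0 (fun n => F (p n)); first by have [] := FP _ (alive_p i).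
have -> : foldl op 1 (mkseq (fun n => F (p n)) k) = p k.
  by elim: k => // k IHk; rewrite mkseqS foldl_rcons IHk.
by move=> pk0; have [w [_ /size0nil-> /=]] := alive_p k 0%N; rewrite pk0.
Qed.

Lemma right_T_nilpotent_bounded (R : pzRingType) (J : set R) (C : seq R) :
  right_T_nilpotent J -> (forall c, c \in C -> J c) ->
  exists k, forall w, {subset w <= C} -> size w = k -> foldl *%R 1 w = 0.
Proof.
move=> nilJ CJ; apply: foldl_eq0_bounded => [|a aC]; first exact: mul0r.
have [k [_ ak0]] := nilJ a (fun i => CJ _ (aC i)); exists k; rewrite -{}ak0.
by elim: k => [|k IHk]; rewrite ?big_ord0 // big_ord_recr mkseqS
  foldl_rcons -IHk.
Qed.

Lemma left_T_nilpotent_bounded (R : pzRingType) (J : set R) (C : seq R) :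
  left_T_nilpotent J -> (forall c, c \in C -> J c) ->
  exists k, forall w, {subset w <= C} -> size w = k ->
    foldl (fun v c => c * v) 1 w = 0.
Proof.
move=> nilJ CJ; apply: foldl_eq0_bounded => [|a aC]; first exact: mulr0.
have [k [_ ak0]] := nilJ a (fun i => CJ _ (aC i)); exists k; rewrite -{}ak0.
elim: k => [|k IHk]; rewrite ?big_ord0 // big_ord_recl mkseqS.
rewrite foldl_rcons -[foldl _ _ _]/(foldl _ 1 (mkseq a k)) IHk /= subSS subn0.
by congr (_ * _); apply: eq_bigr => i _ /=; rewrite /bump /= add1n subSS.
Qed.

Section GroupRingNilpotent.
Variables (R : pzRingType) (G : groupType).
Local Notation mon := (@group_ring_monomial R G).
Local Notation coeff := (@group_ring_coeff R G).
Implicit Types (x y : group_ring R G).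

Lemma group_ring_mon_mul g c y :
  mon g c * y = \sum_(h <- msupp y) mon (g * h)%g (c * coeff h y).
Proof.
rewrite {1}[y]group_ringE mulr_sumr; apply: eq_bigr => h _.
exact: group_ring_mul_monomial.
Qed.

Lemma group_ring_mul_mon g c y :
  y * mon g c = \sum_(h <- msupp y) mon (h * g)%g (coeff h y * c).
Proof.
rewrite {1}[y]group_ringE mulr_suml; apply: eq_bigr => h _.
exact: group_ring_mul_monomial.
Qed.

Lemma group_ring_nilpotent (J : set R) y :
  right_T_nilpotent J \/ left_T_nilpotent J -> (forall g, J (coeff g y)) ->
  exists k : nat, y ^+ k = 0.
Proof.
move=> nilJ Jy; pose C := [seq coeff g y | g <- msupp y].
have CJ c : c \in C -> J c by move=> /mapP[g _ ->].
have inC h : h \in msupp y -> coeff h y \in C by move=> hy; apply: map_f.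
have subC c w : c \in C -> {subset w <= C} -> {subset c :: w <= C}.
  by move=> cC wC d; rewrite inE => /orP[/eqP->|/wC].
case: nilJ => nilJ.
  have [k Ck] := right_T_nilpotent_bounded nilJ CJ; exists k.
  suff kill v g : (forall w, {subset w <= C} -> size w = k ->
      foldl *%R v w = 0) ->
      mon g v * y ^+ k = 0 by rewrite -[LHS]mul1r; apply: kill.
  elim: k v g {Ck} => [|k IHk] v g Cv.
    have -> : v = 0 by apply: (Cv [::]).
    by rewrite raddf0 mul0r.
  rewrite exprS mulrA group_ring_mon_mul mulr_suml big_seq big1 // => h hy.
  apply: IHk => w wC wk; apply: (Cv (coeff h y :: w)) => /=; last by rewrite wk.
  by apply: subC => //; apply: inC.
have [k Ck] := left_T_nilpotent_bounded nilJ CJ; exists k.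
suff kill v g : (forall w, {subset w <= C} -> size w = k ->
    foldl (fun v c => c * v) v w = 0) ->
    y ^+ k * mon g v = 0 by rewrite -[LHS]mulr1; apply: kill.
elim: k v g {Ck} => [|k IHk] v g Cv.
  have -> : v = 0 by apply: (Cv [::]).
  by rewrite raddf0 mulr0.
rewrite exprSr -mulrA group_ring_mul_mon mulr_sumr big_seq big1 // => h hy.
apply: IHk => w wC wk; apply: (Cv (coeff h y :: w)) => /=; last by rewrite wk.
by apply: subC => //; apply: inC.
Qed.

Lemma group_ring_coeffM g x y : coeff g (x * y) =
  \sum_(h <- msupp x) \sum_(k <- msupp y)
    (coeff h x * coeff k y) *+ ((h * k)%g == g).
Proof.
rewrite group_ring_mulE raddf_sum; apply: eq_bigr => h _.
rewrite raddf_sum; apply: eq_bigr => k _; exact: mcoeffU.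
Qed.

End GroupRingNilpotent.

Lemma dvdn_bin_mul_fact N k i : (0 < i <= k)%N -> (N %| 'C(N * k`!, i))%N.
Proof.
case: i => // i /andP[_ le_ik]; have /dvdnP[q qE] := @dvdn_fact i.+1 k le_ik.
suff -> : 'C(N * k`!, i.+1) = (N * (q * 'C((N * k`!).-1, i)))%N.
  exact: dvdn_mulr.
apply/eqP; rewrite -(eqn_pmul2l (ltn0Sn i)) -mul_bin_diag {1}qE; apply/eqP.
by rewrite !mulnA [(N * q * _)%N]mulnC !mulnA.
Qed.

Lemma nilpotent_exprB_periodic (A : pzRingType) (N m n k : nat) (x : A) :
  (0 < N)%N -> N%:R = 0 :> A -> (0 < m < n)%N -> (x ^+ n - x ^+ m) ^+ k = 0 ->
  exists i j : nat, [/\ (0 < i)%N, (0 < j)%N, i <> j & x ^+ i = x ^+ j].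
Proof.
move=> N_gt0 N0 /andP[m_gt0 lt_mn] nil_x.
pose u := x ^+ (n - m); pose z := x ^+ (m * k.+1).
have zu0 i : (k < i)%N -> z * (u - 1) ^+ i = 0.
  move=> lt_ki; rewrite -(subnKC lt_ki) exprD mulrA.
  suff -> : z * (u - 1) ^+ k.+1 = 0 by rewrite mul0r.
  rewrite /z exprM -exprMn_comm.
    by rewrite mulrBr mulr1 -exprD subnKC 1?ltnW // exprSr nil_x mul0r.
  apply: commrB (commr1 _); exact/commrX/commr_sym/commrX.
have zuE : z * u ^+ (N * k`!) = z.
  rewrite -{1}[u](subrK 1) exprD1n mulr_sumr big_ord_recl /= bin0 mulr1n mulr1.
  rewrite big1 ?addr0 // => i _; rewrite mulrnAr.
  have [le_ik|/zu0->] := leqP (bump 0 i) k; last exact: mul0rn.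
  have /dvdnP[q ->] : (N %| 'C(N * k`!, bump 0 i))%N.
    by apply: dvdn_bin_mul_fact; rewrite le_ik.
  by rewrite mulrnA -[_ *+ N]mulr_natr N0 mulr0.
exists (m * k.+1 + (n - m) * (N * k`!))%N, (m * k.+1)%N.
rewrite addn_gt0 muln_gt0 m_gt0; split=> //; last first.
  by rewrite exprD (exprM x (n - m)).
move/eqP; rewrite -[X in _ == X]addn0 eqn_add2l !muln_eq0.
by rewrite subn_eq0 leqNgt lt_mn !eqn0Ngt N_gt0 fact_gt0.
Qed.

Lemma finite_set_seqs (T : eqType) (A : set T) n : finite_set A ->
  finite_set [set w : seq T | size w = n /\ forall t, t \in w -> A t].
Proof.
move=> finA; elim: n => [|n IHn].
  by apply: (sub_finite_set _ (finite_set1 [::])) => w [/size0nil].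
apply: (sub_finite_set _ (finite_image (fun z => z.1 :: z.2)
  (finite_setX finA IHn))) => -[[//]|t w [[wn] Aw]].
exists (t, w) => //; split=> /=; first by apply: Aw; rewrite mem_head.
by split=> // t' t'w; apply: Aw; rewrite inE t'w orbT.
Qed.

Lemma quotient_periodic (R : pzRingType) : periodic_ring R ->
  periodic_ring (jacobson_quotient R).
Proof.
move=> perR u; have [m [n [m_gt0 n_gt0 neq_mn uX]]] := perR (jacobson_repr u).
exists m, n; split=> //; rewrite -[u]jacobson_reprK.
by rewrite -!(rmorphXn (@jacobson_proj R)) uX.
Qed.

(* Modulo [J(R)], the powers of [x] have coefficients in a finite subring and
   support in a finite subgroup. *)
Lemma group_ring_expr_jacobson (R : pzRingType) (G : groupType)
    (x : group_ring R G) :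
  semisimple_ring (jacobson_quotient R) -> periodic_ring R ->
  locally_finite_group G ->
  exists m n : nat, (0 < m < n)%N /\
    forall g, jacobson_radical R (group_ring_coeff g (x ^+ n - x ^+ m)).
Proof.
move=> ssR perR lfG; pose pi := @jacobson_proj R.
pose co g (y : group_ring R G) := group_ring_coeff g y.
have [T [finT subT sT]] := semisimple_periodic_locally_finite
  [seq pi (co g x) | g <- msupp x] ssR (quotient_periodic perR).
have [T0 TD TM] := subT.
have piM a b : pi (a * b) = pi a * pi b by apply: jacobson_projM.
pose H := subgroup_generated [set g | g \in msupp x].
have sub_H g : g \in msupp x -> H g by move=> gx K [_]; apply.
have HM g h : H g -> H h -> H (g * h)%g.
  by move=> Hg Hh K KP; have [[_ KM _] _] := KP; apply: KM; [exact: Hg|exact: Hh].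
have /finite_seqP[hs defH] : finite_set H by apply: lfG; apply: finite_seq.
pose ok y := forall g, T (pi (co g y)) /\ (~ H g -> co g y = 0).
have supp0 g (y : group_ring R G) : g \notin msupp y -> co g y = 0.
  exact: mcoeff_outdom.
have okx : ok x.
  move=> g; have [gx|/supp0 ->] := boolP (g \in msupp x); last first.
    by rewrite /pi raddf0.
  by split=> [|/(_ (sub_H g gx))//]; apply/sT/map_f.
have ok_supp y g : ok y -> g \in msupp y -> H g.
  move=> oky; apply: contraPP => /(proj2 (oky g)) yg0.
  by rewrite -mcoeff_neq0; apply/negP; rewrite negbK; apply/eqP.
have okM y z : ok y -> ok z -> ok (y * z).
  move=> oky okz g; rewrite /co group_ring_coeffM; split=> [|nHg].
    rewrite /pi raddf_sum; apply: (@subrng_sum _ T) => // h _.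
    rewrite raddf_sum; apply: (@subrng_sum _ T) => // k _.
    have [_|_] := (h * k)%g =P g; last by rewrite raddf0.
    rewrite mulr1n [X in T X]piM.
    by apply: TM; [apply: (proj1 (oky h))|apply: (proj1 (okz k))].
  rewrite big_seq big1 // => h /(ok_supp _ _ oky) Hh.
  rewrite big_seq big1 // => k /(ok_supp _ _ okz) Hk.
  by have [hk|//] := (h * k)%g =P g; case: nHg; rewrite -hk; apply: HM.
have okX n : ok (x ^+ n.+1).
  by elim: n => [|n IHn]; rewrite ?expr1 // exprS; apply: okM.
pose v n := [seq pi (co h (x ^+ n.+1)) | h <- hs].
have Av n : size (v n) = size hs /\ forall t, t \in v n -> T t.
  by rewrite size_map; split=> // _ /mapP[h _ ->]; have [] := okX n h.
have [m [n [lt_mn vE]]] :=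
  finite_set_pigeonhole (finite_set_seqs (size hs) finT) Av.
exists m.+1, n.+1; split=> // g; rewrite raddfB.
have [Hg|nHg] := pselect (H g); last first.
  have [J0 _ _] := jacobson_left_ideal R.
  rewrite [X in X - _](proj2 (okX n g) nHg).
  by rewrite [X in _ - X](proj2 (okX m g) nHg) subrr.
have g_hs : g \in hs by move: Hg; rewrite defH.
apply/jacobson_proj_eq; have /(congr1 (nth 0 ^~ (index g hs))) := vE.
by rewrite !(nth_map g) ?index_mem // nth_index.
Qed.

Theorem theorem1p6 (R : pzRingType) (G : groupType) :
  right_perfect R \/ left_perfect R ->
  periodic_ring R ->
  locally_finite_group G ->
  periodic_ring (group_ring R G).
Proof.
move=> perfR perR lfG x.
have [ssR nilJ] : semisimple_ring (jacobson_quotient R) /\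
    (right_T_nilpotent (jacobson_radical R) \/
     left_T_nilpotent (jacobson_radical R)).
  by case: perfR => -[ssR nilJ]; split=> //; [left|right].
have [m [n [mn Jx]]] := group_ring_expr_jacobson x ssR perR lfG.
have [k xk0] := group_ring_nilpotent nilJ Jx.
have [N [N_gt0 N0]] := periodic_ring_natr_eq0 perR.
have RG_N0 : N%:R = 0 :> group_ring R G.
  by rewrite group_ring_oneE -raddfMn /= N0 raddf0.
exact: nilpotent_exprB_periodic N_gt0 RG_N0 mn xk0.
Qed.
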